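(* Let $n \ge 1$, let $\mathcal{P}$ be an admissible partition rule in $\mathbb{R}^n$, and let $\sigma$ be an admissible weight function for $\mathcal{P}$, with positive score constants $A$ and $B$ (the constants in the weighted density average property of $\sigma$). Set $$\theta = \theta_{\mathcal{P},\sigma}(A,B) := \sup_{\Omega \text{ saturated}} \left( \sup_{\mathbf{v} \in \Omega} \mathrm{Score}(\mathcal{D}(\mathbf{v})) \right),$$ where $\mathcal{D}(\mathbf{v})$ is the vertex $D$-star at $\mathbf{v}$, and suppose that $\theta < \kappa_n A$, where $\kappa_n$ is the volume of the unit ball in $\mathbb{R}^n$. Then the maximum sphere packing density $\delta(\mathbf{B}_n)$ satisfies $$\delta(\mathbf{B}_n) \le \frac{\kappa_n B}{\kappa_n A - \theta}.$$
   Context: Notation. $\mathbf{B}_n = \{\mathbf{x} \in \mathbb{R}^n : \|\mathbf{x}\| \le 1\}$ is the unit ball, with volume $\kappa_n = \pi^{n/2}/\Gamma(\frac{n}{2}+1)$. Sphere packings and density. A sphere packing is specified by a set $\Omega \subset \mathbb{R}^n$ of sphere centers with $\|\mathbf{v}-\mathbf{v}'\| \ge 2$ for all distinct $\mathbf{v},\mathbf{v}' \in \Omega$; the packing is $\Omega + \mathbf{B}_n$. For a bounded region $S$, the density of the packing in $S$ is $$\rho(S) = \rho(\Omega,S) := \frac{\mathrm{vol}(S \cap (\Omega + \mathbf{B}_n))}{\mathrm{vol}(S)}.$$ For $T>0$ put $\bar\rho(\Omega,T) := \sup_{\mathbf{x} \in \mathbb{R}^n} \rho(\Omega, [0,T]^n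 + \mathbf{x})$. The upper packing density of $\Omega$ is $\bar\rho(\Omega) := \limsup_{T \to \infty} \bar\rho(\Omega,T)$, and the (maximum) sphere packing density is $\delta(\mathbf{B}_n) := \sup_\Omega \bar\rho(\Omega)$, the supremum being over all sphere packings $\Omega$. A sphere packing $\Omega$ is saturated if no new sphere centers can be added to it (i.e. it is not a proper subset of another set of sphere centers with pairwise distances at least $2$). Admissible partition rule. This is a rule assigning to each saturated packing $\Omega$ in $\mathbb{R}^n$ a collection of closed sets $\mathcal{P}(\Omega) = \{R_\alpha\} = \{R_\alpha(\Omega)\}$ with the following properties. (i) Partition: each $R_\alpha$ is a finite union of bounded convex polyhedra; the sets $R_\alpha$ cover $\mathbb{R}^n$ and have pairwise disjoint interiors. (ii) Locality: there is a positive constant $C$ (independent of $\Omega$) such that each $R_\alpha$ has diameter at most $C$; each $R_\alpha$ is completely determined by the set of sphere centers $\mathbf{w} \in \Omega$ with $\mathrm{distance}(\mathbf{w},R_\alpha) \le C$; and at most $C$ regions intersect any cube of side $1$. (iii) Translation-invariance: the partition assigned to the translated packing $\Omega' = \Omega + \mathbf{x}$ consists of the sets $\{R_\alpha(\Omega) + \mathbf{x}\}$. Admissible weight function. For an admissible partition rule $\mathcal{P}$ in $\mathbb{R}^n$, an admissible weight function (or score function) $\sigma$ assigns, for each saturated $\Omega$, to each region $R_\alpha \in \mathcal{P}(\Omega)$ and each $\mathbf{v} \in \Omega$ a real weight $\sigma(R_\alpha,\mathbf{v})$ (negative values are allowed), with $|\sigma(R_\alpha,\mathbf{v})| < C^*$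 for an absolute constant $C^*$, such that: (i) Weighted density average: there are positive constants $A$ and $B$ (independent of $\Omega$), called the score constants, such that for each $R_\alpha$, $$\sum_{\mathbf{v} \in \Omega} \sigma(R_\alpha,\mathbf{v}) = (A\,\rho(R_\alpha) - B)\,\mathrm{vol}(R_\alpha),$$ where $\rho(R_\alpha)\,\mathrm{vol}(R_\alpha) = \mathrm{vol}(R_\alpha \cap (\Omega + \mathbf{B}_n))$. (ii) Locality: there is an absolute constant $C$ (independent of $\Omega$) such that each value $\sigma(R_\alpha,\mathbf{v})$ is completely determined by the set of sphere centers $\mathbf{w} \in \Omega$ with $\|\mathbf{w}-\mathbf{v}\| \le C$; furthermore $\sigma(R_\alpha,\mathbf{v}) = 0$ if $\mathrm{dist}(\mathbf{v},R_\alpha) > C$. (iii) Translation-invariance: the weight function $\sigma'$ assigned to the translated packing $\Omega' = \Omega + \mathbf{x}$ satisfies $\sigma'(R_\alpha + \mathbf{x}, \mathbf{v} + \mathbf{x}) = \sigma(R_\alpha,\mathbf{v})$. Vertex $D$-star and score. For $\Omega$ saturated and $\mathbf{v} \in \Omega$, the vertex $D$-star $\mathcal{D}(\mathbf{v})$ consists of all sets $R_\alpha \in \mathcal{P}(\Omega)$ such that $\sigma(R_\alpha,\mathbf{v}) \ne 0$. Its total score is $$\mathrm{Score}(\mathcal{D}(\mathbf{v})) := \sum_{R_\alpha \in \mathcal{D}(\mathbf{v})} \sigma(R_\alpha,\mathbf{v}).$$ *)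

(* Defs.v *)
From HB Require Import structures.
From mathcomp Require Import all_boot all_order all_algebra.
From mathcomp Require Import finmap.
From mathcomp Require Import all_classical all_reals all_analysis.

Set Implicit Arguments.
Unset Strict Implicit.
Unset Printing Implicit Defensive.

Import Order.TTheory GRing.Theory Num.Theory.
Import numFieldNormedType.Exports.

Local Open Scope classical_set_scope.
Local Open Scope ring_scope.

(* The canonical norm on 'rV[R]_n is the max norm; distances between points
   are measured with the Euclidean norm below. Both norms have the same
   topology and the same bounded sets. *)
Definition enorm (R : realType) (n : nat) (x : 'rV[R]_n) : R :=
  Num.sqrt (\sum_(i < n) x ord0 i ^+ 2).

Definition unit_ball (R : realType) (n : nat) : set 'rV[R]_n :=
  [set x | enorm x <= 1].

(* Extended-real valued, so that every point is at distance +oo from set0. *)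
Definition distance (R : realType) (n : nat) (x : 'rV[R]_n)
    (S : set 'rV[R]_n) : \bar R :=
  ereal_inf [set (enorm (x - y))%:E | y in S].

Definition diameter (R : realType) (n : nat) (S : set 'rV[R]_n) : \bar R :=
  ereal_sup [set (enorm (p.1 - p.2))%:E | p in S `*` S].

Definition translate (R : realType) (n : nat) (S : set 'rV[R]_n)
    (x : 'rV[R]_n) : set 'rV[R]_n :=
  [set y + x | y in S].

Definition cube (R : realType) (n : nat) (T : R) : set 'rV[R]_n :=
  [set y | forall i, 0 <= y ord0 i <= T].

(* n-dimensional Lebesgue measure: the n-fold product of the one-dimensional
   Lebesgue measure, on the iterated product R * (R * (... * unit)),
   transported to row vectors. Like the library's product measure it is
   meaningful on Borel sets only; all sets measured below are Borel. *)
Fixpoint power_display (R : realType) (n : nat) : measure_display :=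
  if n is m.+1 then
    measure_prod_display
      (sigma_display (@measurable _ (ocitv_type R)), power_display R m)
  else default_measure_display.

Fixpoint power (R : realType) (n : nat) : measurableType (power_display R n) :=
  match n return measurableType (power_display R n) with
  | 0 => unit
  | m.+1 => (measurableTypeR R * power R m)%type
  end.

Fixpoint power_lebesgue (R : realType) (n : nat) : set (power R n) -> \bar R :=
  match n return set (power R n) -> \bar R with
  | 0 => dirac tt
  | m.+1 => product_measure1 (@lebesgue_measure R) (@power_lebesgue R m)
  end.

Fixpoint row_of_power (R : realType) (n : nat) : power R n -> 'rV[R]_n :=
  match n return power R n -> 'rV[R]_n with
  | 0 => fun=> 0
  | m.+1 => fun p =>
      row_mx (const_mx p.1 : 'rV[R]_1) (row_of_power p.2) : 'rV[R]_(1 + m)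
  end.

(* Real-valued; only used for bounded sets, which have finite measure. *)
Definition vol (R : realType) (n : nat) (S : set 'rV[R]_n) : R :=
  fine (power_lebesgue (@row_of_power R n @^-1` S)).

Definition kappa (R : realType) (n : nat) : R := vol (@unit_ball R n).

Definition sphere_packing (R : realType) (n : nat) (Omega : set 'rV[R]_n) :
    Prop :=
  forall v w, Omega v -> Omega w -> v != w -> 2 <= enorm (v - w).

Definition saturated (R : realType) (n : nat) (Omega : set 'rV[R]_n) : Prop :=
  sphere_packing Omega /\
  forall Omega', sphere_packing Omega' -> Omega `<=` Omega' -> Omega' = Omega.

Definition packed_region (R : realType) (n : nat) (Omega : set 'rV[R]_n) :
    set 'rV[R]_n :=
  [set v + b | v in Omega & b in @unit_ball R n].

Definition density (R : realType) (n : nat) (Omega S : set 'rV[R]_n) : R :=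
  vol (S `&` packed_region Omega) / vol S.

Definition max_cube_density (R : realType) (n : nat) (Omega : set 'rV[R]_n)
    (T : R) : \bar R :=
  ereal_sup
    [set (density Omega (translate (cube T) x))%:E | x in [set: 'rV[R]_n]].

Definition upper_density (R : realType) (n : nat) (Omega : set 'rV[R]_n) :
    \bar R :=
  limf_esup (max_cube_density Omega) (pinfty_nbhs R).

Definition packing_density (R : realType) (n : nat) : \bar R :=
  ereal_sup
    [set upper_density Omega | Omega in [set O | @sphere_packing R n O]].

(* Solution set of a finite system of linear inequalities M x <= b. *)
Definition convex_polyhedron (R : realType) (n : nat) (S : set 'rV[R]_n) :
    Prop :=
  exists (m : nat) (M : 'M[R]_(m, n)) (b : 'cV[R]_m),
    S = [set x | forall i, (M *m x^T) i ord0 <= b i ord0].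

Definition finite_union_of_polyhedra (R : realType) (n : nat)
    (S : set 'rV[R]_n) : Prop :=
  exists (k : nat) (F : 'I_k -> set 'rV[R]_n),
    (forall i, bounded_set (F i) /\ convex_polyhedron (F i)) /\
    S = \bigcup_i F i.

(* A partition rule maps a set of sphere centers to a set of regions; only
   its values on saturated packings are constrained. *)
Definition partition_rule (R : realType) (n : nat) : Type :=
  set 'rV[R]_n -> set (set 'rV[R]_n).

Definition partition_axiom (R : realType) (n : nat) (P : partition_rule R n) :
    Prop :=
  forall Omega, saturated Omega ->
    [/\ forall Q, P Omega Q -> closed Q /\ finite_union_of_polyhedra Q,
        \bigcup_(Q in P Omega) Q = [set: 'rV[R]_n]
      & forall Q Q', P Omega Q -> P Omega Q' -> Q <> Q' ->
          interior Q `&` interior Q' = set0].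

(* The second clause says that a region is determined by the centers near it:
   a saturated packing with the same centers near Q also has the region Q. *)
Definition partition_locality (R : realType) (n : nat)
    (P : partition_rule R n) : Prop :=
  exists C : R, 0 < C /\
    [/\ forall Omega Q, saturated Omega -> P Omega Q ->
          (diameter Q <= C%:E)%E,
        forall Omega Omega' Q, saturated Omega -> saturated Omega' ->
          P Omega Q ->
          [set w | Omega w /\ (distance w Q <= C%:E)%E] =
          [set w | Omega' w /\ (distance w Q <= C%:E)%E] ->
          P Omega' Q
      & forall Omega x, saturated Omega ->
          let hit := [set Q | P Omega Q /\ Q `&` translate (cube 1) x !=set0] in
          finite_set hit /\ (#|` fset_set hit|)%:R <= C].

Definition partition_translation (R : realType) (n : nat)
    (P : partition_rule R n) : Prop :=
  forall Omega x, saturated Omega ->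
    P (translate Omega x) = [set translate Q x | Q in P Omega].

Definition admissible_partition (R : realType) (n : nat)
    (P : partition_rule R n) : Prop :=
  [/\ partition_axiom P, partition_locality P & partition_translation P].

(* [sigma Omega Q v] is the weight given to the region Q and the center v;
   only the values with Omega saturated, Q in P Omega and v in Omega matter. *)
Definition weight_function (R : realType) (n : nat) : Type :=
  set 'rV[R]_n -> set 'rV[R]_n -> 'rV[R]_n -> R.

Definition weight_bounded (R : realType) (n : nat) (P : partition_rule R n)
    (sigma : weight_function R n) : Prop :=
  exists C : R, forall Omega Q v, saturated Omega -> P Omega Q -> Omega v ->
    `|sigma Omega Q v| < C.

(* The sum over Omega has finite support for an admissible weight function. *)
Definition weighted_density_average (R : realType) (n : nat)
    (P : partition_rule R n) (sigma : weight_function R n) (A B : R) : Prop :=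
  forall Omega Q, saturated Omega -> P Omega Q ->
    \sum_(v \in Omega) sigma Omega Q v = (A * density Omega Q - B) * vol Q.

Definition weight_locality (R : realType) (n : nat) (P : partition_rule R n)
    (sigma : weight_function R n) : Prop :=
  exists C : R,
    (forall Omega Omega' Q v, saturated Omega -> saturated Omega' ->
       P Omega Q -> P Omega' Q -> Omega v -> Omega' v ->
       [set w | Omega w /\ enorm (w - v) <= C] =
       [set w | Omega' w /\ enorm (w - v) <= C] ->
       sigma Omega Q v = sigma Omega' Q v) /\
    (forall Omega Q v, saturated Omega -> P Omega Q -> Omega v ->
       (C%:E < distance v Q)%E -> sigma Omega Q v = 0).

Definition weight_translation (R : realType) (n : nat)
    (P : partition_rule R n) (sigma : weight_function R n) : Prop :=
  forall Omega Q v x, saturated Omega -> P Omega Q -> Omega v ->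
    sigma (translate Omega x) (translate Q x) (v + x) = sigma Omega Q v.

(* [A] and [B] are the score constants. *)
Definition admissible_weight (R : realType) (n : nat) (P : partition_rule R n)
    (sigma : weight_function R n) (A B : R) : Prop :=
  [/\ 0 < A, 0 < B & weight_bounded P sigma] /\
  [/\ weighted_density_average P sigma A B, weight_locality P sigma
    & weight_translation P sigma].

Definition vertex_star (R : realType) (n : nat) (P : partition_rule R n)
    (sigma : weight_function R n) (Omega : set 'rV[R]_n) (v : 'rV[R]_n) :
    set (set 'rV[R]_n) :=
  [set Q | P Omega Q /\ sigma Omega Q v != 0].

(* The star is a finite set of regions when P and sigma are admissible. *)
Definition score (R : realType) (n : nat) (P : partition_rule R n)
    (sigma : weight_function R n) (Omega : set 'rV[R]_n) (v : 'rV[R]_n) : R :=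
  \sum_(Q \in vertex_star P sigma Omega v) sigma Omega Q v.

Definition theta (R : realType) (n : nat) (P : partition_rule R n)
    (sigma : weight_function R n) : \bar R :=
  ereal_sup
    [set ereal_sup [set (score P sigma Omega v)%:E | v in Omega]
    | Omega in [set O | @saturated R n O]].

(* Main.v *)
(* Let theta be the supremum of the scores and let K be a large cube.  Sum the
   weights sigma(Q, v) over the regions Q meeting K and over all centers v.
   Summed over v first, the density average gives at least
   A vol(K `&` packed) - B vol(K) up to a boundary term, since the regions
   meeting K cover K, overlap in null sets and stay at bounded distance from K.
   Summed over Q first, every center deep inside K contributes its full score,
   at most theta, and the centers near the boundary of K contribute a bounded
   amount each.  There are vol(K `&` packed) / kappa centers in K up to a
   boundary term, so
     (A - theta / kappa) vol(K `&` packed) <= B vol(K) + o(vol K)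
   uniformly in the position of K and in the packing.  An arbitrary packing is
   contained in a saturated one, which has larger density. *)
Require Import Defs.
From HB Require Import structures.
From mathcomp Require Import all_boot all_order all_algebra.
From mathcomp Require Import finmap.
From mathcomp Require Import all_classical all_reals all_analysis.
From mathcomp Require Import measurable_realfun.
From mathcomp Require Import lra ring.

Set Implicit Arguments.
Unset Strict Implicit.
Unset Printing Implicit Defensive.
Import Order.TTheory GRing.Theory Num.Theory.
Import numFieldNormedType.Exports.
Local Open Scope classical_set_scope.
Local Open Scope ring_scope.

(** * Lebesgue measure on rows *)

Section product_sigma_finite.
Context d1 d2 (T1 : measurableType d1) (T2 : measurableType d2) (R : realType).
Variables (m1 : {sigma_finite_measure set T1 -> \bar R})
  (m2 : {sigma_finite_measure set T2 -> \bar R}).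

(** The products of two exhaustions exhaust the product space. Both exhaustions are taken
    nondecreasing, so a point of [F i] times [G j] already lies in the product of index
    [maxn i j]. *)
Lemma product_measure1_sigma_finite :
  sigma_finite setT (product_measure1 m1 m2).
Proof.
have /sigma_finiteP[F [FT ndF Foo]] := sigma_finiteT m1.
have /sigma_finiteP[G [GT ndG Goo]] := sigma_finiteT m2.
exists (fun k => F k `*` G k).
  apply/esym; rewrite -subTset => -[x y] _.
  have [i _ Fx] : (\bigcup_i F i) x by rewrite -FT.
  have [j _ Gy] : (\bigcup_j G j) y by rewrite -GT.
  exists (maxn i j) => //; split=> /=.
    by move: x Fx; exact/subsetPset/ndF/leq_maxl.
  by move: y Gy; exact/subsetPset/ndG/leq_maxr.
move=> k; have [mF Fk] := Foo k; have [mG Gk] := Goo k.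
split; first exact: measurableX.
by rewrite product_measure1E// lte_mul_pinfty// ge0_fin_numE.
Qed.

(* Alias carrying the sigma-finite structure, which the library does not attach
   to [product_measure1] itself. *)
Definition sigma_finite_product : set (T1 * T2) -> \bar R :=
  product_measure1 m1 m2.

HB.instance Definition _ := Measure.on sigma_finite_product.
HB.instance Definition _ := Measure_isSigmaFinite.Build _ _ _
  sigma_finite_product product_measure1_sigma_finite.

End product_sigma_finite.

Section lebesgue_rows.
Context (R : realType).

Local Arguments row_of_power : simpl never.

(** The same measure as [power_lebesgue], carrying at every level the sigma-finite structure
    required by the uniqueness and product formulas. *)
Fixpoint power_measure (n : nat) :
    {sigma_finite_measure set (power R n) -> \bar R} :=
  match n return {sigma_finite_measure set (power R n) -> \bar R} with
  | 0 => (@dirac _ unit tt R : {sigma_finite_measure set (power R 0) -> \bar R})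
  | m.+1 => (sigma_finite_product (@lebesgue_measure R) (power_measure m) :
       {sigma_finite_measure
          set (measurableTypeR R * power R m)%type -> \bar R})
  end.

Lemma power_measureE n :
  power_measure n = @power_lebesgue R n :> (set _ -> \bar R).
Proof. by elim: n => //= n IH; rewrite -IH. Qed.

Lemma row_of_power0 n (p : power R n.+1) : row_of_power p ord0 ord0 = p.1.
Proof.
transitivity ((const_mx p.1 : 'rV[R]_1) ord0 ord0); last by rewrite mxE.
rewrite -(@row_mxEl _ 1 1 n _ (row_of_power p.2)).
by congr (row_mx _ _ _ _); exact/val_inj.
Qed.

Lemma row_of_power_lift n (p : power R n.+1) j :
  row_of_power p ord0 (lift ord0 j) = row_of_power p.2 ord0 j.
Proof. by rewrite -rshift1 (@row_mxEr _ 1 1 n). Qed.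

Lemma measurable_coord n (i : 'I_n) :
  measurable_fun [set: power R n] (fun p => row_of_power p ord0 i).
Proof.
elim: n i => [[]//|n IH] i.
case: (unliftP ord0 i) => [j|] -> /=.
  rewrite (_ : (fun _ => _) = (fun p => row_of_power p ord0 j) \o snd).
    by apply: measurableT_comp => //; exact: IH.
  by apply/funext => p; exact: row_of_power_lift.
rewrite (_ : (fun _ => _) = fst); first exact: measurable_fst.
by apply/funext => p; exact: row_of_power0.
Qed.

Definition measurable_rows n (S : set 'rV[R]_n) : Prop :=
  measurable (@row_of_power R n @^-1` S).

Definition mu_rows n (S : set 'rV[R]_n) : \bar R :=
  power_measure n (@row_of_power R n @^-1` S).

Lemma fine_mu_rows n (S : set 'rV[R]_n) : vol S = fine (mu_rows S).
Proof. by rewrite /vol /mu_rows power_measureE. Qed.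

(** Translation transported to iterated products. The recursion exhibits it as a product map, so
    that preimages of rectangles are rectangles. *)
Fixpoint power_add n : 'rV[R]_n -> power R n -> power R n :=
  match n return 'rV[R]_n -> power R n -> power R n with
  | 0 => fun _ p => p
  | m.+1 => fun x p =>
      (p.1 + x ord0 ord0, power_add (\row_j x ord0 (lift ord0 j)) p.2)
  end.

Lemma row_ext n (u v : 'rV[R]_n) : (forall i, u ord0 i = v ord0 i) -> u = v.
Proof. by move=> uv; apply/rowP => i; exact: uv. Qed.

Lemma row_of_power_add n x (p : power R n) :
  row_of_power (power_add x p) = row_of_power p + x.
Proof.
elim: n x p => [|n IH] x p; first by apply: row_ext => -[].
apply: row_ext => i; rewrite [RHS]mxE.
case: (unliftP ord0 i) => [j|] -> ; last by rewrite !row_of_power0.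
by rewrite !row_of_power_lift IH !mxE.
Qed.

Lemma measurable_power_add n x : measurable_fun setT (@power_add n x).
Proof.
elim: n x => [|n IH] x /=; first exact: measurable_id.
apply: measurable_fun_pair.
  by apply: measurable_funD => //; exact: measurable_fst.
by apply: measurableT_comp => //; exact: measurable_snd.
Qed.

(** The pushforward under the shift agrees with Lebesgue measure on half-open intervals, so the two
    measures coincide by uniqueness. *)
Lemma lebesgue_measure_addr (x : R) (A : set (measurableTypeR R)) :
  measurable A ->
  lebesgue_measure ((+%R^~ x) @^-1` A) = lebesgue_measure A.
Proof.
move=> mA.
pose shift : measurableTypeR R -> measurableTypeR R := +%R^~ x.
have mshift : measurable_fun [set: measurableTypeR R] shift.
  exact: measurable_funD.
apply/esym.
apply: (@lebesgue_measure_unique R (pushforward (@lebesgue_measure R) shift))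
  => //= _ [[a b]] _ <-.
rewrite /pushforward.
rewrite (_ : _ @^-1` _ = `]a - x, b - x]%classic).
  by rewrite !lebesgue_measure_itv/= !lte_fin ltrD2r -!EFinB opprB addrA subrK.
by apply/seteqP; split => y /=; rewrite !in_itv/= ltrBlDr lerBrDr.
Qed.

(** By uniqueness of the product measure it is enough to compare on rectangles, where the two
    factors are handled by the one-dimensional case and the induction hypothesis. *)
Lemma power_measure_add n x (A : set (power R n)) : measurable A ->
  power_measure n (power_add x @^-1` A) = power_measure n A.
Proof.
elim: n x A => [//|n IH] x A mA.
have mT := @measurable_power_add n.+1 x.
have mT' := @measurable_power_add n (\row_j x ord0 (lift ord0 j)).
have m1 : measurable_fun setT
    ((+%R^~ (x ord0 ord0)) : measurableTypeR R -> measurableTypeR R).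
  exact: measurable_funD.
apply/esym.
apply: (@product_measure_unique _ _ _ _ R (@lebesgue_measure R) (power_measure n)
  (pushforward (power_measure n.+1) (@power_add n.+1 x))) => // B C mB mC.
transitivity (power_measure n.+1 (((+%R^~ (x ord0 ord0)) @^-1` B) `*`
  (power_add (\row_j x ord0 (lift ord0 j)) @^-1` C))) => //.
rewrite [LHS]product_measure1E.
- by rewrite IH//; congr (_ * _)%E; exact: lebesgue_measure_addr.
- by rewrite -[_ @^-1` _]setTI; exact: m1.
- by rewrite -[X in measurable X]setTI; exact: mT'.
Qed.

Lemma measurable_preimage_add n x (A : set (power R n)) : measurable A ->
  measurable (power_add x @^-1` A).
Proof.
by move=> mA; rewrite -[X in measurable X]setTI; exact: measurable_power_add.
Qed.

Lemma row_of_power_translate n (S : set 'rV[R]_n) x :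
  @row_of_power R n @^-1` translate S x =
  power_add (- x) @^-1` (@row_of_power R n @^-1` S).
Proof.
apply/seteqP; split => [p [y Sy yp]|p Sp] /=.
  by rewrite row_of_power_add -yp addrK.
by exists (row_of_power (power_add (- x) p)) => //; rewrite row_of_power_add subrK.
Qed.

Lemma measurable_rows_translate n (S : set 'rV[R]_n) x :
  measurable_rows S -> measurable_rows (translate S x).
Proof.
move=> mS; rewrite /measurable_rows row_of_power_translate.
exact: measurable_preimage_add.
Qed.

Lemma mu_rows_translate n (S : set 'rV[R]_n) x :
  measurable_rows S -> mu_rows (translate S x) = mu_rows S.
Proof.
by move=> mS; rewrite /mu_rows row_of_power_translate power_measure_add.
Qed.

(** Cubes are given by center and half-side, so that moving inwards or outwards by a margin only
    changes [r]. *)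
Definition box n (c : 'rV[R]_n) (r : R) : set 'rV[R]_n :=
  [set y | forall i, `|y ord0 i - c ord0 i| <= r].

Lemma row_of_power_box n (c : 'rV[R]_n.+1) r :
  @row_of_power R n.+1 @^-1` box c r =
  `[c ord0 ord0 - r, c ord0 ord0 + r]%classic `*`
  (@row_of_power R n @^-1` box (\row_j c ord0 (lift ord0 j)) r).
Proof.
apply/seteqP; split => [p pb|p [p1 p2] i].
  split => /=.
    by have := pb ord0; rewrite row_of_power0 ler_distl in_itv.
  by move=> j; have := pb (lift ord0 j); rewrite row_of_power_lift mxE.
case: (unliftP ord0 i) => [j|] ->; last first.
  by rewrite row_of_power0 ler_distl; move: p1; rewrite /= in_itv.
by have := p2 j; rewrite row_of_power_lift mxE.
Qed.

Lemma measurable_box n (c : 'rV[R]_n) r : measurable_rows (box c r).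
Proof.
rewrite /measurable_rows; elim: n c => [c|n IH c] //.
by rewrite row_of_power_box; apply: measurableX => //; exact: measurable_itv.
Qed.

Lemma mu_box n (c : 'rV[R]_n) r : 0 <= r ->
  mu_rows (box c r) = ((2 * r) ^+ n)%:E.
Proof.
rewrite /mu_rows => r0; elim: n c => [c|n IH c].
  rewrite expr0 /= diracE (_ : tt \in _) //.
  by rewrite inE => -[].
rewrite row_of_power_box [LHS]product_measure1E//; last first.
  exact: measurable_box.
rewrite IH exprS EFinM; congr *%E.
rewrite [LHS]lebesgue_measure_itv/= lte_fin.
case: ifPn => [_|].
  by rewrite -EFinB; congr EFin; ring.
rewrite -leNgt => ?; congr EFin; lra.
Qed.

Lemma measurable_linear n (a : 'I_n -> R) :
  measurable_fun [set: power R n] (fun p => \sum_i a i * row_of_power p ord0 i).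
Proof.
apply: measurable_sum => i; apply: measurable_funM => //.
exact: measurable_coord.
Qed.

Lemma measurable_halfspace n (a : 'I_n -> R) b :
  measurable_rows [set x : 'rV[R]_n | \sum_i a i * x ord0 i <= b].
Proof.
rewrite /measurable_rows (_ : _ @^-1` _ =
    (fun p => \sum_i a i * row_of_power p ord0 i) @^-1` `]-oo, b]%classic).
  rewrite -[X in measurable X]setTI; exact: measurable_linear.
by apply/seteqP; split => p /=; rewrite in_itv.
Qed.

Lemma measurable_hyperplane n (a : 'I_n -> R) b :
  measurable_rows [set x : 'rV[R]_n | \sum_i a i * x ord0 i = b].
Proof.
rewrite /measurable_rows (_ : _ @^-1` _ =
    (fun p => \sum_i a i * row_of_power p ord0 i) @^-1` [set b]) //.
rewrite -[X in measurable X]setTI; exact: measurable_linear.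
Qed.

(* By Fubini: along the first coordinate, either every section is a hyperplane
   one dimension below, or all sections but one are empty. *)
Lemma mu_hyperplane n (a : 'I_n -> R) b i : a i != 0 ->
  mu_rows [set x : 'rV[R]_n | \sum_i a i * x ord0 i = b] = 0%E.
Proof.
rewrite /mu_rows; elim: n a b i => [a b []//|n IH a b i ai].
pose H := @row_of_power R n.+1 @^-1`
  [set x : 'rV[R]_n.+1 | \sum_i a i * x ord0 i = b].
have HE (x : R) : xsection H x = @row_of_power R n @^-1`
    [set y | \sum_j a (lift ord0 j) * y ord0 j = b - a ord0 * x].
  apply/seteqP; split => p.
    rewrite /xsection /H /= inE /= big_ord_recl row_of_power0 /= => <-.
    rewrite addrC addKr; apply: eq_bigr => j _.
    by rewrite row_of_power_lift.
  rewrite /xsection /H /= inE /= big_ord_recl row_of_power0 /= => e.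
  rewrite -[RHS](subrKC (a ord0 * x)) -e; congr (_ + _); apply: eq_bigr => j _.
  by rewrite row_of_power_lift.
rewrite [LHS]/(\int[lebesgue_measure]_x power_measure n (xsection H x))%E.
have [/existsP[j aj]|/existsPn a0] := boolP [exists j, a (lift ord0 j) != 0].
  by apply: integral0_eq => x _; rewrite HE (IH (fun j => a (lift ord0 j)) _ j).
have a00 : a ord0 != 0.
  case: (unliftP ord0 i) ai => [j|] -> //.
  by move=> aj; have := a0 j; rewrite aj.
have -> : H = [set b / a ord0] `*` setT.
  apply/seteqP; split => p; rewrite /H /= big_ord_recl row_of_power0 big1 ?addr0.
  - by move=> <-; split => //; rewrite mulrC mulKf.
  - by move=> j _; move/negPn/eqP: (a0 j) => ->; rewrite mul0r.
  - by move=> [-> _]; rewrite mulrC divfK.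
  - by move=> j _; move/negPn/eqP: (a0 j) => ->; rewrite mul0r.
rewrite [LHS]product_measure1E//.
(* The second factor may have infinite measure; the product is still 0 by the convention on extended
   reals. *)
transitivity (0 * power_measure n setT)%E; last exact: mul0e.
congr (_ * _)%E; exact: lebesgue_measure_set1.
Qed.

End lebesgue_rows.

(** * Volumes of bounded measurable sets *)

Section volume.
Context (R : realType).

(** The sets on which [vol] is faithful: their measure is finite, so nothing is lost by [fine]. *)
Definition bounded_measurable n (S : set 'rV[R]_n) : Prop :=
  measurable_rows S /\ exists r, S `<=` box 0 r.

Lemma bounded_measurable_box n (c : 'rV[R]_n) r : bounded_measurable (box c r).
Proof.
split; first exact: measurable_box.
exists (r + \sum_i `|c ord0 i|) => x xc i; rewrite mxE subr0.
rewrite -(subrK (c ord0 i) (x ord0 i)) (le_trans (ler_normD _ _))// lerD//.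
by rewrite (bigD1 i)//= lerDl sumr_ge0.
Qed.

Lemma bounded_measurable_subset n (S S' : set 'rV[R]_n) : measurable_rows S ->
  S `<=` S' -> bounded_measurable S' -> bounded_measurable S.
Proof.
by move=> mS SS' [_ [r S'r]]; split => //; exists r; exact: subset_trans S'r.
Qed.

Lemma bounded_measurableI n (S S' : set 'rV[R]_n) : bounded_measurable S ->
  measurable_rows S' -> bounded_measurable (S `&` S').
Proof.
move=> bS mS'; have [mS _] := bS.
apply: bounded_measurable_subset bS; last exact: subIsetl.
exact: measurableI.
Qed.

Lemma bounded_measurableU n (S S' : set 'rV[R]_n) : bounded_measurable S ->
  bounded_measurable S' -> bounded_measurable (S `|` S').
Proof.
move=> [mS [r Sr]] [mS' [r' Sr']]; split; first exact: measurableU.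
by exists (Num.max r r') => x [/Sr|/Sr'] xr i; rewrite le_max xr ?orbT.
Qed.

Lemma bounded_measurable0 n : bounded_measurable (set0 : set 'rV[R]_n).
Proof. by split; [exact: measurable0|exists 0]. Qed.

Lemma bounded_measurable_bigU n (I : eqType) (s : seq I) (F : I -> set 'rV[R]_n) :
  (forall i, i \in s -> bounded_measurable (F i)) ->
  bounded_measurable (\big[setU/set0]_(i <- s) F i).
Proof.
move=> bF; rewrite big_seq.
by apply: big_ind => //; [exact: bounded_measurable0|exact: bounded_measurableU].
Qed.

Lemma mu_rows_fin n (S : set 'rV[R]_n) : bounded_measurable S ->
  mu_rows S \is a fin_num.
Proof.
move=> [mS [r Sr]]; rewrite ge0_fin_numE//.
have Sb : S `<=` box 0 `|r|.
  by move=> x /Sr xr i; apply: le_trans (xr i) (ler_norm r).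
apply: (@le_lt_trans _ _ (mu_rows (box 0 `|r|))).
  by apply: le_measure; rewrite ?inE//; [exact: measurable_box|move=> p; exact: Sb].
by rewrite mu_box// ltry.
Qed.

Lemma volE n (S : set 'rV[R]_n) : bounded_measurable S ->
  (vol S)%:E = mu_rows S.
Proof. by move=> bS; rewrite fine_mu_rows fineK// mu_rows_fin. Qed.

Lemma vol_ge0 n (S : set 'rV[R]_n) : 0 <= vol S.
Proof. by rewrite fine_mu_rows fine_ge0// measure_ge0. Qed.

Lemma vol0 n : vol (set0 : set 'rV[R]_n) = 0.
Proof. by rewrite fine_mu_rows /mu_rows preimage_set0 measure0. Qed.

Lemma le_vol n (S S' : set 'rV[R]_n) : measurable_rows S ->
  bounded_measurable S' -> S `<=` S' -> vol S <= vol S'.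
Proof.
move=> mS bS' SS'; have bS := bounded_measurable_subset mS SS' bS'.
rewrite -lee_fin !volE//; apply: le_measure; rewrite ?inE//; first by case: bS'.
by move=> p; exact: SS'.
Qed.

Lemma vol_box n (c : 'rV[R]_n) r : 0 <= r -> vol (box c r) = (2 * r) ^+ n.
Proof. by move=> r0; rewrite fine_mu_rows mu_box. Qed.

Lemma vol_translate n (S : set 'rV[R]_n) x : measurable_rows S ->
  vol (translate S x) = vol S.
Proof. by move=> mS; rewrite !fine_mu_rows mu_rows_translate. Qed.

Lemma vol_setU_le n (S S' : set 'rV[R]_n) : bounded_measurable S ->
  bounded_measurable S' -> vol (S `|` S') <= vol S + vol S'.
Proof.
move=> bS bS'; rewrite -lee_fin EFinD !volE//; last exact: bounded_measurableU.
by rewrite /mu_rows preimage_setU; apply: measureU2; [case: bS|case: bS'].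
Qed.

(** Inclusion-exclusion, where finiteness of the measures makes the subtraction legitimate. Regions
    of a partition and balls of a packing touch along null sets, so exact disjointness cannot be
    assumed. *)
Lemma vol_setU_null n (S S' : set 'rV[R]_n) : bounded_measurable S ->
  bounded_measurable S' -> vol (S `&` S') = 0 -> vol (S `|` S') = vol S + vol S'.
Proof.
move=> bS bS' /eqP; have [[mS _] [mS' _]] := (bS, bS').
have bI := bounded_measurableI bS mS'.
have bU := bounded_measurableU bS bS'.
rewrite -eqe volE// => /eqP I0; apply/eqP; rewrite -eqe EFinD !volE//; apply/eqP.
have := I0; rewrite /mu_rows preimage_setU preimage_setI => I0'.
have := mu_rows_fin bS'; rewrite ge0_fin_numE// => S'oo.
by rewrite measureUfinr// [X in (_ - X)%E]I0' sube0.
Qed.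

Lemma vol_bigU_le n (I : eqType) (s : seq I) (F : I -> set 'rV[R]_n) :
  (forall i, i \in s -> bounded_measurable (F i)) ->
  vol (\big[setU/set0]_(i <- s) F i) <= \sum_(i <- s) vol (F i).
Proof.
elim: s => [|i s IH] bF; first by rewrite !big_nil vol0.
have bFs j : j \in s -> bounded_measurable (F j).
  by move=> js; apply: bF; rewrite inE js orbT.
rewrite !big_cons (le_trans (vol_setU_le _ _)) ?lerD2l ?IH//.
  by apply: bF; rewrite inE eqxx.
exact: bounded_measurable_bigU.
Qed.

Lemma vol_subset_null n (S S' : set 'rV[R]_n) : measurable_rows S ->
  bounded_measurable S' -> S `<=` S' -> vol S' = 0 -> vol S = 0.
Proof.
by move=> mS bS' SS' S'0; apply/eqP; rewrite eq_le vol_ge0 -S'0 le_vol.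
Qed.

Lemma vol_bigU_null n (I : eqType) (s : seq I) (F : I -> set 'rV[R]_n) :
  uniq s -> (forall i, i \in s -> bounded_measurable (F i)) ->
  (forall i j, i \in s -> j \in s -> i != j -> vol (F i `&` F j) = 0) ->
  vol (\big[setU/set0]_(i <- s) F i) = \sum_(i <- s) vol (F i).
Proof.
elim: s => [|i s IH] /=; first by rewrite !big_nil vol0.
move=> /andP[si us] bF F0.
have bFs j : j \in s -> bounded_measurable (F j).
  by move=> js; apply: bF; rewrite inE js orbT.
have bFi : bounded_measurable (F i) by apply: bF; rewrite inE eqxx.
have bU := bounded_measurable_bigU bFs.
rewrite !big_cons vol_setU_null//.
  by rewrite IH// => j k js ks; apply: F0; rewrite inE ?js ?ks orbT.
have bI j : j \in s -> bounded_measurable (F i `&` F j).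
  by move=> js; apply: bounded_measurableI => //; case: (bFs j js).
(* The first set meets the union of the others in a finite union of null sets. *)
apply/eqP; rewrite eq_le vol_ge0 andbT setIC big_distrl/=.
under eq_bigr do rewrite setIC.
rewrite (le_trans (vol_bigU_le bI))// big_seq big1// => j js.
by apply: F0; rewrite ?inE ?eqxx ?js ?orbT//; apply: contraNneq si => ->.
Qed.

Lemma vol_hyperplane n (S : set 'rV[R]_n) (a : 'I_n -> R) b i :
  measurable_rows S -> S `<=` [set x | \sum_i a i * x ord0 i = b] ->
  a i != 0 -> vol S = 0.
Proof.
move=> mS Sab ai; rewrite fine_mu_rows (_ : mu_rows S = 0%E)//.
apply/eqP; rewrite eq_le measure_ge0 andbT.
rewrite -(mu_hyperplane b ai); apply: le_measure; rewrite ?inE//.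
  exact: measurable_hyperplane.
by move=> p; exact: Sab.
Qed.

End volume.

(** * Unit balls and sphere packings *)

Section packing.
Context (R : realType).

Lemma enorm_ge0 n (x : 'rV[R]_n) : 0 <= enorm x.
Proof. exact: sqrtr_ge0. Qed.

Lemma enorm_sqr n (x : 'rV[R]_n) : enorm x ^+ 2 = \sum_(i < n) x ord0 i ^+ 2.
Proof. by rewrite sqr_sqrtr// sumr_ge0// => i _; exact: sqr_ge0. Qed.

Lemma enorm_le n (x : 'rV[R]_n) r : 0 <= r ->
  (enorm x <= r) = (\sum_(i < n) x ord0 i ^+ 2 <= r ^+ 2).
Proof. by move=> r0; rewrite -enorm_sqr ler_sqr// nnegrE ?enorm_ge0. Qed.

Lemma coord_le_enorm n (x : 'rV[R]_n) i : `|x ord0 i| <= enorm x.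
Proof.
rewrite -ler_sqr ?nnegrE ?enorm_ge0// enorm_sqr real_normK ?num_real//.
by rewrite (bigD1 i)//= lerDl sumr_ge0// => j _; exact: sqr_ge0.
Qed.

Definition ball_at n (v : 'rV[R]_n) : set 'rV[R]_n := translate (@unit_ball R n) v.

Lemma ball_atP n (v x : 'rV[R]_n) : ball_at v x <-> enorm (x - v) <= 1.
Proof.
split=> [[b b1 <-]|xv]; first by rewrite addrK.
by exists (x - v); rewrite ?subrK.
Qed.

Lemma ball_at_box n (v : 'rV[R]_n) : ball_at v `<=` box v 1.
Proof.
move=> x /ball_atP xv i; rewrite (le_trans _ xv)//.
by have := coord_le_enorm (x - v) i; rewrite !mxE.
Qed.

Lemma measurable_unit_ball n : measurable_rows (@unit_ball R n).
Proof.
rewrite /measurable_rows (_ : _ @^-1` _ =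
    (fun p => \sum_i row_of_power p ord0 i ^+ 2) @^-1` `]-oo, 1]%classic).
  rewrite -[X in measurable X]setTI; apply: (_ : measurable_fun _ _) => //.
  by apply: measurable_sum => i; apply: measurable_funX; exact: measurable_coord.
by apply/seteqP; split => p; rewrite /= in_itv/= /unit_ball/= enorm_le// expr1n.
Qed.

Lemma bounded_measurable_ball_at n (v : 'rV[R]_n) : bounded_measurable (ball_at v).
Proof.
apply: bounded_measurable_subset (@ball_at_box n v) (bounded_measurable_box v 1).
exact/measurable_rows_translate/measurable_unit_ball.
Qed.

Lemma vol_ball_at n (v : 'rV[R]_n) : vol (ball_at v) = kappa R n.
Proof. exact/vol_translate/measurable_unit_ball. Qed.

(** The ball contains the cube of half-side [1 / (n + 1)], since a sum of [n] squares, each at most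
    [1 / (n + 1)], is at most 1. Taking [n + 1] also covers dimension 0. *)
Lemma kappa_gt0 n : 0 < kappa R n.
Proof.
have n1 : 0 < n.+1%:R^-1 :> R by rewrite invr_gt0.
apply: (@lt_le_trans _ _ (vol (box (0 : 'rV[R]_n) n.+1%:R^-1))).
  by rewrite vol_box ?ltW// exprn_gt0// mulr_gt0.
rewrite -(vol_ball_at 0); apply: le_vol (bounded_measurable_ball_at 0) _.
  exact: measurable_box.
move=> x xb; apply/ball_atP; rewrite subr0 enorm_le// expr1n.
apply: (@le_trans _ _ (\sum_(i < n) n.+1%:R^-1)).
  apply: ler_sum => i _; have := xb i; rewrite mxE subr0 => xi.
  have n0 := ltW n1; rewrite -real_normK ?num_real//.
  rewrite (le_trans (lerXn2r 2 _ _ xi)) ?nnegrE//= expr2 ler_piMr//.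
  by rewrite invf_le1// ler1n.
by rewrite sumr_const card_ord -[_ *+ n]mulr_natl ler_pdivrMr// mul1r ler_nat.
Qed.

(* By the parallelogram identity, unit balls whose centers are at distance at
   least 2 meet at most in the midpoint of their centers. *)
Lemma ball_at_midpoint n (v w x : 'rV[R]_n) i : 2 <= enorm (v - w) ->
  ball_at v x -> ball_at w x -> 2 * x ord0 i = v ord0 i + w ord0 i.
Proof.
move=> vw /ball_atP xv /ball_atP xw.
have : enorm (x - v + (x - w)) ^+ 2 <= 0.
  have -> : enorm (x - v + (x - w)) ^+ 2 =
      2 * enorm (x - v) ^+ 2 + 2 * enorm (x - w) ^+ 2 - enorm (v - w) ^+ 2.
    rewrite !enorm_sqr !mulr_sumr -big_split/= -sumrB; apply: eq_bigr => j _.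
    by rewrite !mxE; ring.
  have e1 u : enorm (x - u) <= 1 -> enorm (x - u) ^+ 2 <= 1.
    by move=> ?; rewrite expr_le1// enorm_ge0.
  have := e1 _ xv; have := e1 _ xw.
  have : 2 ^+ 2 <= enorm (v - w) ^+ 2 by rewrite ler_sqr ?nnegrE ?enorm_ge0.
  by rewrite expr2; lra.
rewrite exprn_even_le0//= => /eqP e0.
have := coord_le_enorm (x - v + (x - w)) i; rewrite e0 normr_le0 !mxE => /eqP.
by move=> h; lra.
Qed.

(** A common point has a prescribed coordinate [i0], hence lies in a hyperplane; [0 < n] supplies
    this coordinate. *)
Lemma vol_ballI n (v w : 'rV[R]_n) : (0 < n)%N -> 2 <= enorm (v - w) ->
  vol (ball_at v `&` ball_at w) = 0.
Proof.
move=> n0 vw; pose i0 := Ordinal n0.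
apply: (@vol_hyperplane _ _ _ (fun j => 2 * (j == i0)%:R) (v ord0 i0 + w ord0 i0) i0).
- apply: measurableI; first by case: (bounded_measurable_ball_at v).
  by case: (bounded_measurable_ball_at w).
- move=> x [xv xw] /=; rewrite -(ball_at_midpoint i0 vw xv xw).
  rewrite (bigD1 i0)//= ?eqxx mulr1 big1 ?addr0// => j /negbTE ->.
  by rewrite mulr0 mul0r.
- by rewrite eqxx mulr1 pnatr_eq0.
Qed.

Lemma vol_balls n (Omega : set 'rV[R]_n) (s : seq 'rV[R]_n) : (0 < n)%N ->
  sphere_packing Omega -> uniq s -> (forall v, v \in s -> Omega v) ->
  vol (\big[setU/set0]_(v <- s) ball_at v) = kappa R n * (size s)%:R.
Proof.
move=> n0 pO us sO; rewrite vol_bigU_null//.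
- rewrite (eq_bigr (fun=> kappa R n)) => [|v _]; last exact: vol_ball_at.
  by rewrite big_const_seq count_predT iter_addr_0 mulr_natr.
- by move=> v _; exact: bounded_measurable_ball_at.
- by move=> v w vs ws vw; apply: vol_ballI => //; apply: pO => //; exact: sO.
Qed.

Lemma bigU_ballP n (s : seq 'rV[R]_n) x :
  (\big[setU/set0]_(v <- s) ball_at v) x <-> exists2 v, v \in s & ball_at v x.
Proof. by rewrite -bigcup_seq; split => [[v ? ?]|[v ? ?]]; exists v. Qed.

Lemma bounded_measurable_balls n (s : seq 'rV[R]_n) :
  bounded_measurable (\big[setU/set0]_(v <- s) ball_at v).
Proof.
by apply: bounded_measurable_bigU => v _; exact: bounded_measurable_ball_at.
Qed.

(** Converts counts of centers into volumes: the balls overlap in null sets and all fit in [S]. *)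
Lemma packing_count n (Omega S : set 'rV[R]_n) (s : seq 'rV[R]_n) : (0 < n)%N ->
  sphere_packing Omega -> uniq s -> (forall v, v \in s -> Omega v) ->
  bounded_measurable S -> (forall v, v \in s -> ball_at v `<=` S) ->
  kappa R n * (size s)%:R <= vol S.
Proof.
move=> n0 pO us sO bS sS; rewrite -(vol_balls n0 pO us sO); apply: le_vol => //.
  by case: (bounded_measurable_balls s).
by move=> x /bigU_ballP[v /sS]; apply.
Qed.

Lemma box_ball n (c v : 'rV[R]_n) r s : r + 1 <= s -> box c r v ->
  ball_at v `<=` box c s.
Proof.
move=> rs cv x /ball_at_box xv i; rewrite (le_trans _ rs)//.
rewrite (_ : x ord0 i - _ = (v ord0 i - c ord0 i) + (x ord0 i - v ord0 i)).
  by rewrite (le_trans (ler_normD _ _))// lerD// ?cv ?xv.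
by ring.
Qed.

Lemma finite_packing_box n (Omega : set 'rV[R]_n) c r : (0 < n)%N ->
  sphere_packing Omega -> finite_set (Omega `&` box c r).
Proof.
move=> n0 pO; apply: contrapT => inf.
have k0 := kappa_gt0 n.
(* More centers than the volume of the enlarged box can accommodate. *)
pose N := (Num.truncn (vol (box c (r + 1)) / kappa R n)).+1.
have [B BO NB] := @infinite_set_fset _ _ N inf.
have : kappa R n * #|` B|%:R <= vol (box c (r + 1)).
  apply: (packing_count n0 pO); first exact: fset_uniq.
  - by move=> v /BO[].
  - exact: bounded_measurable_box.
  - by move=> v /BO[_]; exact: box_ball.
rewrite mulrC -ler_pdivlMr//; apply/negP; rewrite -ltNge.
apply: (@lt_le_trans _ _ N%:R); last by rewrite ler_nat.
by rewrite /N truncnS_gt.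
Qed.

Lemma packed_regionP n (Omega : set 'rV[R]_n) x :
  packed_region Omega x <-> exists2 v, Omega v & ball_at v x.
Proof.
split=> [[v Ov [b b1 <-]]|[v Ov /ball_atP xv]].
  by exists v => //; exists b => //; rewrite addrC.
by exists v => //; exists (x - v); rewrite // addrC subrK.
Qed.

(** Inside a bounded set the packed region is a finite union of balls: only centers within distance
    1 of the enclosing box matter. *)
Lemma measurable_packed n (Omega S : set 'rV[R]_n) : (0 < n)%N ->
  sphere_packing Omega -> bounded_measurable S ->
  bounded_measurable (S `&` packed_region Omega).
Proof.
move=> n0 pO bS; have [_ [r Sr]] := bS.
have fO := finite_packing_box (0 : 'rV[R]_n) (r + 1) n0 pO.
rewrite (_ : S `&` _ = S `&`
    \big[setU/set0]_(v <- fset_set (Omega `&` box 0 (r + 1))) ball_at v).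
  by apply: bounded_measurableI bS _; case: (bounded_measurable_balls
    (fset_set (Omega `&` box 0 (r + 1)))).
apply/seteqP; split => x [Sx]; last first.
  move=> /bigU_ballP[v]; rewrite in_fset_set// inE => -[Ov _] xv.
  by split => //; apply/packed_regionP; exists v.
move=> /packed_regionP[v Ov xv]; split => //; apply/bigU_ballP; exists v => //.
rewrite in_fset_set// inE; split => // i.
rewrite (_ : v ord0 i - _ =
    (x ord0 i - (0 : 'rV[R]_n) ord0 i) - (x ord0 i - v ord0 i)).
  rewrite (le_trans (ler_normB _ _))// lerD//; first exact: Sr.
  exact: (ball_at_box xv).
by ring.
Qed.

(** Zorn's lemma, applied to the sets whose union with [Omega] is a packing rather than to the
    packings containing [Omega]: the empty chain then needs no separate treatment, its union being
    the empty set. *)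
Lemma saturation n (Omega : set 'rV[R]_n) : sphere_packing Omega ->
  exists2 Omega', saturated Omega' & Omega `<=` Omega'.
Proof.
move=> pO.
pose PP := [set O : set 'rV[R]_n | sphere_packing (O `|` Omega)].
have [F FP tF|A [PA maxA]] := @Zorn_bigcup _ PP.
  move=> v w [[X FX Xv]|Ov] [[Y FY Yw]|Ow] vw.
  - have [XY|YX] := tF _ _ FX FY.
      by apply: (FP _ FY) => //; left => //; exact: XY.
    by apply: (FP _ FX) => //; left => //; exact: YX.
  - by apply: (FP _ FX) => //; [left|right].
  - by apply: (FP _ FY) => //; [right|left].
  - exact: pO.
exists (A `|` Omega); last exact: subsetUr.
split => // O' pO' AO'.
have AsO' : A `<=` O' by exact: subset_trans AO'.
apply/seteqP; split => //; apply: contrapT => nO'A.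
apply: (maxA (O')).
  split => // O'A; apply: nO'A; apply: subset_trans O'A _; exact: subsetUl.
rewrite /PP/= (_ : O' `|` Omega = O')//.
by apply/setUidPl; exact: subset_trans AO'.
Qed.

Lemma saturated_nonempty n (Omega : set 'rV[R]_n) : saturated Omega -> Omega !=set0.
Proof.
move=> [pO sO]; apply: contrapT => /set0P/negP/negPn/eqP O0.
have := sO [set 0]; rewrite O0 => /(_ _ _)/esym.
move=> /(_ _ _)/seteqP[]//.
- by move=> v w /= -> -> /eqP.
- by move=> _ /(_ 0); apply.
Qed.

End packing.

(** * Polyhedra *)

Section polyhedra.
Context (R : realType).

Definition hyperplane n (h : ('I_n -> R) * R) : set 'rV[R]_n :=
  [set x | \sum_i h.1 i * x ord0 i = h.2].

(** A combinatorial form of being null, stable under finite unions and subsets without any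
    measurability condition. It is applied to boundaries of regions. *)
Definition thin n (S : set 'rV[R]_n) : Prop :=
  exists s : seq (('I_n -> R) * R), (forall h, h \in s -> exists i, h.1 i != 0) /\
    forall x, S x -> exists2 h, h \in s & hyperplane h x.

Lemma thin_subset n (S S' : set 'rV[R]_n) : S `<=` S' -> thin S' -> thin S.
Proof. by move=> SS' [s [s0 sS]]; exists s; split => // x /SS'; exact: sS. Qed.

Lemma thinU n (S S' : set 'rV[R]_n) : thin S -> thin S' -> thin (S `|` S').
Proof.
move=> [s [s0 sS]] [s' [s'0 sS']]; exists (s ++ s'); split.
  by move=> h; rewrite mem_cat => /orP[/s0|/s'0].
by move=> x [/sS|/sS'] [h hs hx]; exists h => //; rewrite mem_cat hs ?orbT.
Qed.

Lemma thin_bigU n (k : nat) (F : 'I_k -> set 'rV[R]_n) : (forall i, thin (F i)) ->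
  thin (\bigcup_i F i).
Proof.
move=> tF; have [f fP] := choice tF.
exists (flatten [seq f i | i <- enum 'I_k]); split.
  by move=> h /flatten_mapP[i _]; have [+ _] := fP i; apply.
move=> x [i _ Fx]; have [_ /(_ _ Fx)[h hf hx]] := fP i.
by exists h => //; apply/flatten_mapP; exists i => //; rewrite mem_enum.
Qed.

Lemma vol_thin n (S : set 'rV[R]_n) : bounded_measurable S -> thin S -> vol S = 0.
Proof.
move=> bS [s [s0 sS]].
have bH h : bounded_measurable (S `&` hyperplane h).
  by apply: bounded_measurableI => //; exact: measurable_hyperplane.
apply/eqP; rewrite eq_le vol_ge0 andbT.
apply: (@le_trans _ _ (vol (\big[setU/set0]_(h <- s) (S `&` hyperplane h)))).
  apply: le_vol; [by case: bS|by apply: bounded_measurable_bigU|].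
  by move=> x Sx; have [h hs hx] := sS _ Sx; rewrite -bigcup_seq; exists h.
rewrite (le_trans (vol_bigU_le _))// big_seq big1// => h /s0[i hi].
apply: (vol_hyperplane _ _ hi); last exact: subIsetr.
by case: (bH h).
Qed.

Lemma mul_row_tr m n (M : 'M[R]_(m, n)) (x : 'rV[R]_n) i :
  (M *m x^T) i ord0 = \sum_j M i j * x ord0 j.
Proof. by rewrite mxE; apply: eq_bigr => j _; rewrite mxE. Qed.

Lemma measurable_polyhedron n (S : set 'rV[R]_n) : convex_polyhedron S ->
  measurable_rows S.
Proof.
move=> [m [M [b ->]]].
rewrite (_ : [set _ | _] = \big[setI/setT]_(i <- enum 'I_m)
    [set x : 'rV[R]_n | \sum_j M i j * x ord0 j <= b i ord0]).
  rewrite /measurable_rows; apply: (big_ind (@measurable_rows R n)).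
  - exact: measurableT.
  - by move=> ? ? ? ?; exact: measurableI.
  - by move=> i _; exact: measurable_halfspace.
rewrite -bigcap_seq; apply/seteqP; split => x h i.
  by move=> _ /=; rewrite -mul_row_tr.
by rewrite mul_row_tr; apply: (h i); rewrite /= mem_enum.
Qed.

Lemma continuous_linear_form n (a : 'I_n -> R) :
  continuous (fun x : 'rV[R]_n => \sum_i a i * x ord0 i).
Proof.
rewrite (_ : (fun _ => _) = \sum_i (fun x : 'rV[R]_n => a i * x ord0 i)).
  apply: (big_ind (fun f : 'rV[R]_n -> R => continuous f)).
  - by move=> x; exact: cst_continuous.
  - by move=> f g cf cg x; apply: continuousD; [exact: cf|exact: cg].
  - move=> i _ x; apply: continuousM; first exact: cst_continuous.
    exact: coord_continuous.
by apply/funext => x; rewrite fct_sumE.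
Qed.

(* A point of a polyhedron lying on no bounding hyperplane is interior. *)
Lemma thin_polyhedron_boundary n (S : set 'rV[R]_n) : convex_polyhedron S ->
  thin (S `\` interior S).
Proof.
move=> [m [M [b ->]]].
pose s := [seq ((fun j => M i j), b i ord0)
  | i <- enum 'I_m & [exists j, M i j != 0]].
exists s; split.
  by move=> _ /mapP[i + ->]; rewrite mem_filter => /andP[/existsP].
move=> x [Sx nSx]; apply: contrapT => nh; apply: nSx.
apply: (@filter_forall _ _
  (fun i y => (M *m y^T) i ord0 <= b i ord0) (nbhs x)) => i.
have [Mi|/existsPn Mi] := boolP [exists j, M i j != 0].
  have lt_b : \sum_j M i j * x ord0 j < b i ord0.
    rewrite lt_neqAle -mul_row_tr Sx andbT; apply/eqP => e; apply: nh.
    exists ((fun j => M i j), b i ord0); last by rewrite /hyperplane/= -mul_row_tr.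
    by apply/mapP; exists i => //; rewrite mem_filter Mi mem_enum.
  have := @continuous_linear_form n (fun j => M i j) x.
  move=> /cvgr_lt /(_ _ lt_b); apply: filterS => y /ltW.
  by rewrite mul_row_tr.
(* A zero row gives an inequality independent of the point; it holds at [x], hence everywhere. *)
apply: nearW => y; have := Sx i; rewrite !mul_row_tr !big1// => j _;
  by move/negPn/eqP: (Mi j) => ->; rewrite mul0r.
Qed.

Lemma measurable_region n (Q : set 'rV[R]_n) : finite_union_of_polyhedra Q ->
  measurable_rows Q.
Proof.
move=> [k [F [FP ->]]].
rewrite (_ : \bigcup_i F i = \big[setU/set0]_(i <- enum 'I_k) F i).
  apply: (big_ind (@measurable_rows R n)).
  - exact: measurable0.
  - by move=> ? ? ? ?; exact: measurableU.
  - by move=> i _; apply: measurable_polyhedron; exact: (FP i).2.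
rewrite -bigcup_seq; apply/seteqP; split => x [i _ Fx]; exists i => //=.
by rewrite mem_enum.
Qed.

(** The interior of a union contains the interiors of its members, so a boundary point of the union
    is a boundary point of some polyhedron. *)
Lemma thin_region_boundary n (Q : set 'rV[R]_n) : finite_union_of_polyhedra Q ->
  thin (Q `\` interior Q).
Proof.
move=> [k [F [FP ->]]].
apply: (@thin_subset _ _ (\bigcup_i (F i `\` interior (F i)))).
  move=> x [[i _ Fx] nx]; exists i => //; split => // Fix; apply: nx.
  by move: Fix; apply: interiorS => y Fy; exists i.
by apply: thin_bigU => i; apply: thin_polyhedron_boundary; exact: (FP i).2.
Qed.

Lemma vol_regionI n (Q Q' : set 'rV[R]_n) : finite_union_of_polyhedra Q ->
  finite_union_of_polyhedra Q' -> bounded_measurable Q ->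
  interior Q `&` interior Q' = set0 -> vol (Q `&` Q') = 0.
Proof.
move=> fQ fQ' bQ QQ'; apply: vol_thin.
  by apply: bounded_measurableI => //; exact: measurable_region.
apply: thin_subset (thinU (thin_region_boundary fQ) (thin_region_boundary fQ')).
move=> x [Qx Q'x].
have [Qox|Qox] := pselect (interior Q x); last by left.
have [Q'ox|Q'ox] := pselect (interior Q' x); last by right.
by have : (interior Q `&` interior Q') x by []; rewrite QQ'.
Qed.

End polyhedra.

(** * Regions near a box *)

Section locality.
Context (R : realType).

(** The box is covered by [k ^ n] translated unit cubes, each hit by at most [C] regions. The bound
    depends on neither the packing nor the center of the box, which keeps the boundary terms
    uniform. *)
Lemma finite_hits n (P : partition_rule R n) (C : R) :
  (forall Omega x, saturated Omega ->
     let hit := [set Q | P Omega Q /\ Q `&` translate (@cube R n 1) x !=set0] in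
     finite_set hit /\ (#|` fset_set hit|)%:R <= C) ->
  forall r, exists N : R, forall Omega c, saturated Omega ->
    exists s : seq (set 'rV[R]_n), [/\ uniq s, (size s)%:R <= N
      & forall Q, Q \in s <-> P Omega Q /\ Q `&` box c r !=set0].
Proof.
move=> hitP r.
pose k := (Num.truncn (2 * r)).+1.
pose N : R := #|{: {ffun 'I_n -> 'I_k}}|%:R * C.
exists N => Omega c sO.
pose x (f : {ffun 'I_n -> 'I_k}) : 'rV[R]_n := \row_i (c ord0 i - r + (f i)%:R).
pose hit (f : {ffun 'I_n -> 'I_k}) :=
  [set Q | P Omega Q /\ Q `&` translate (cube 1) (x f) !=set0].
have fhit f : finite_set (hit f) by have [] := hitP Omega (x f) sO.
have chit f : (#|` fset_set (hit f)|)%:R <= C by have [] := hitP Omega (x f) sO.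
pose s0 : seq (set 'rV[R]_n) := flatten
  [seq enum_fset (fset_set (hit f)) | f <- enum {: {ffun 'I_n -> 'I_k}}].
have s0N : (size s0)%:R <= N.
  rewrite size_flatten /shape -map_comp sumnE big_map natr_sum /N cardE.
  rewrite mulr_natl -count_predT -[leRHS]addr0 -iter_addr -big_const_seq.
  by apply: ler_sum => f _; exact: chit.
exists (undup [seq Q <- s0 | `[< Q `&` box c r !=set0 >]]); split.
- exact: undup_uniq.
- apply: le_trans s0N; rewrite ler_nat (leq_trans (size_undup _))//.
  by rewrite size_filter count_size.
move=> Q; rewrite mem_undup mem_filter; split.
  move=> /andP[/asboolP Qb /flatten_mapP[f _]].
  by rewrite in_fset_set// inE => -[PQ _].
move=> [PQ Qb]; apply/andP; split; first exact/asboolP.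
have [y [Qy yb]] := Qb.
have y0 i : 0 <= y ord0 i - c ord0 i + r by have := yb i; rewrite ler_norml; lra.
have yk i : (Num.truncn (y ord0 i - c ord0 i + r) < k)%N.
  by rewrite ltnS le_truncn//; have := yb i; rewrite ler_norml; lra.
(* The unit cube containing [y] is indexed by the integer parts of its offsets from the lowest
   corner of the box. *)
apply/flatten_mapP; exists [ffun i => Ordinal (yk i)]; first by rewrite mem_enum.
rewrite in_fset_set// inE; split => //; exists y; split => //.
exists (y - x [ffun i => Ordinal (yk i)]); last by rewrite subrK.
move=> i; rewrite !mxE ffunE/=; have := truncn_itv (y0 i).
by rewrite -natr1 => /andP[]; lra.
Qed.

(** The distance to a region is an infimum, so a point of the region is only extracted within any
    larger bound; hence [C + 1]. *)
Lemma weight_near n (P : partition_rule R n) (sigma : weight_function R n) :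
  weight_locality P sigma -> exists D : R, forall Omega Q v, saturated Omega ->
    P Omega Q -> Omega v -> sigma Omega Q v != 0 -> exists2 y, Q y & box v D y.
Proof.
move=> [C [_ far]]; exists (C + 1) => Omega Q v sO PQ Ov s0.
have : (distance v Q <= C%:E)%E.
  by rewrite leNgt; apply: contraNN s0 => /(far _ _ _ sO PQ Ov) ->.
move=> dC; have : (distance v Q < (C + 1)%:E)%E.
  by rewrite (le_lt_trans dC)// lte_fin ltrDl.
move=> /ereal_inf_lt[_ [y Qy <-]]; rewrite lte_fin => vy.
exists y => // i; rewrite distrC (le_trans _ (ltW vy))//.
by have := coord_le_enorm (v - y) i; rewrite !mxE.
Qed.

Lemma diameter_box n (Q : set 'rV[R]_n) C y : (diameter Q <= C%:E)%E -> Q y ->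
  Q `<=` box y C.
Proof.
move=> dQ Qy x Qx i; rewrite -lee_fin (le_trans _ dQ)//.
apply: (@le_trans _ _ (enorm (x - y))%:E).
  by rewrite lee_fin; have := coord_le_enorm (x - y) i; rewrite !mxE.
by apply: ereal_sup_ubound; exists (x, y).
Qed.

Lemma box_trans n (c v x : 'rV[R]_n) r s q : r + s <= q -> box c r v -> box v s x ->
  box c q x.
Proof.
move=> rsq cv vx i; rewrite (le_trans _ rsq)//.
rewrite (_ : x ord0 i - _ = (v ord0 i - c ord0 i) + (x ord0 i - v ord0 i)).
  by rewrite (le_trans (ler_normD _ _))// lerD// ?cv ?vx.
by ring.
Qed.

Lemma box_sym n (c x : 'rV[R]_n) r : box c r x -> box x r c.
Proof. by move=> cx i; rewrite distrC. Qed.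

End locality.

(** * The score estimate on a box *)

Section estimate.
Context (R : realType).

Lemma ler_sum_seq_const (I : eqType) (s : seq I) (f : I -> R) (a : R) :
  (forall i, i \in s -> f i <= a) -> \sum_(i <- s) f i <= a * (size s)%:R.
Proof.
move=> fa; rewrite big_seq (le_trans (ler_sum _ fa))// -big_seq.
by rewrite big_const_seq count_predT iter_addr_0 mulr_natr.
Qed.

Lemma density_mul n (Omega Q : set 'rV[R]_n) (A B : R) : (0 < n)%N ->
  sphere_packing Omega -> bounded_measurable Q ->
  (A * density Omega Q - B) * vol Q =
  A * vol (Q `&` packed_region Omega) - B * vol Q.
Proof.
move=> n0 pO bQ; rewrite mulrBl -mulrA; congr (_ * _ - _).
(* For a null region the density is a division by zero, but the packed part is null as well. *)
rewrite /density; have [Q0|Q0] := eqVneq (vol Q) 0; last by rewrite divfK.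
have [mQO _] := measurable_packed n0 pO bQ.
by rewrite Q0 mulr0 (vol_subset_null mQO bQ)//; exact: subIsetl.
Qed.

(** The double count for one packing and one box of half-side [r]. A single margin [D] bounds the
    size of regions, the range of weights and the radius of balls. The regions counted lie in
    half-side [r + D], the centers they charge in [r + 2 * D]; [N * W] bounds what one center
    receives. *)
Lemma box_density_bound n (Omega : set 'rV[R]_n) (PO : set (set 'rV[R]_n))
    (sg : set 'rV[R]_n -> 'rV[R]_n -> R) (A B D N W t : R) : (0 < n)%N ->
  sphere_packing Omega ->
  0 <= A -> 0 <= B -> 1 <= D -> 0 <= N -> 0 <= W ->
  (forall Q, PO Q -> finite_union_of_polyhedra Q) ->
  \bigcup_(Q in PO) Q = [set: 'rV[R]_n] ->
  (forall Q Q', PO Q -> PO Q' -> Q <> Q' -> interior Q `&` interior Q' = set0) ->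
  (forall Q y, PO Q -> Q y -> Q `<=` box y D) ->
  (forall Q v, PO Q -> Omega v -> sg Q v != 0 -> exists2 y, Q y & box v D y) ->
  (forall c r, exists s : seq (set 'rV[R]_n), uniq s /\
     forall Q, Q \in s <-> PO Q /\ Q `&` box c r !=set0) ->
  (forall c, exists s : seq (set 'rV[R]_n), (size s)%:R <= N /\
     forall Q, Q \in s <-> PO Q /\ Q `&` box c D !=set0) ->
  (forall Q v, PO Q -> Omega v -> `|sg Q v| <= W) ->
  (forall Q, PO Q ->
     \sum_(v \in Omega) sg Q v = (A * density Omega Q - B) * vol Q) ->
  (forall v, Omega v -> \sum_(Q \in [set Q | PO Q /\ sg Q v != 0]) sg Q v <= t) ->
  forall c r, 2 * D <= r ->
  A * vol (box c r `&` packed_region Omega) <=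
   B * (2 * (r + D)) ^+ n
   + t * vol (box c r `&` packed_region Omega) / kappa R n
   + (`|t| + N * W) / kappa R n
     * ((2 * (r + 3 * D)) ^+ n - (2 * (r - 2 * D)) ^+ n).
Proof.
move=> n0 pO A0 B0 D1 N0 W0 polP covP disjP diamP nearP hitP hitNP bndP avgP scoreP
  c r Dr.
set u := vol _.
have k0 := kappa_gt0 R n.
have [sF [usF sFP]] := hitP c r.
have fV := finite_packing_box c (r + 2 * D) n0 pO.
pose sV : seq 'rV[R]_n := fset_set (Omega `&` box c (r + 2 * D)).
have usV : uniq sV by exact: fset_uniq.
have sVP v : (v \in sV) <-> Omega v /\ box c (r + 2 * D) v.
  by rewrite /sV in_fset_set// inE.
have sFb Q : Q \in sF -> Q `<=` box c (r + D).
  move=> /sFP[PQ [y [Qy cy]]] x /(diamP _ _ PQ Qy); exact: box_trans cy.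
have bF Q : Q \in sF -> bounded_measurable Q.
  move=> QF; apply: bounded_measurable_subset (sFb _ QF) (bounded_measurable_box _ _).
  by apply/measurable_region/polP; have [] := (sFP Q).1 QF.
have bFW Q : Q \in sF -> bounded_measurable (Q `&` packed_region Omega).
  by move=> /bF; exact: measurable_packed.
have bu : bounded_measurable (box c r `&` packed_region Omega).
  exact: measurable_packed (bounded_measurable_box c r).
have volF : \sum_(Q <- sF) vol Q <= (2 * (r + D)) ^+ n.
  have rD : 0 <= r + D by lra.
  rewrite -(vol_box c rD) -(vol_bigU_null usF bF).
    apply: le_vol; first by case: (bounded_measurable_bigU bF).
      exact: bounded_measurable_box.
    by move=> x; rewrite -bigcup_seq => -[Q QF]; exact: sFb.
  move=> Q Q' QF QF' QQ'; have [PQ _] := (sFP Q).1 QF; have [PQ' _] := (sFP Q').1 QF'.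
  apply: vol_regionI; [exact: polP|exact: polP|exact: bF|].
  by apply: disjP => //; exact/eqP.
have volu : u <= \sum_(Q <- sF) vol (Q `&` packed_region Omega).
  apply: le_trans (vol_bigU_le bFW); apply: le_vol; first by case: bu.
    exact: bounded_measurable_bigU.
  move=> x [cx xO]; rewrite -bigcup_seq.
  have [Q PQ Qx] : (\bigcup_(Q in PO) Q) x by rewrite covP.
  by exists Q => //=; apply/sFP; split => //; exists x.
have total : A * u - B * (2 * (r + D)) ^+ n <=
    \sum_(v <- sV) \sum_(Q <- sF) sg Q v.
  rewrite exchange_big/=.
  apply: (@le_trans _ _ (\sum_(Q <- sF)
      (A * vol (Q `&` packed_region Omega) - B * vol Q))).
    by rewrite sumrB -!mulr_sumr lerB// ler_wpM2l.
  rewrite big_seq [leRHS]big_seq; apply: ler_sum => Q QF.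
  have [PQ [z [Qz cz]]] := (sFP Q).1 QF.
  rewrite -density_mul//; last exact: bF.
  (* The list [sV] contains the support of [sg Q]: a center with nonzero weight is within [D] of a
     point of [Q], and [Q] lies in the box of half-side [r + D]. *)
  rewrite -avgP// (fsbigE sV)//.
  - rewrite big_seq_cond [leRHS]big_seq le_eqVlt; apply/orP; left; apply/eqP.
    apply: eq_bigl => v; apply/andP/idP => [[]//|vV]; split; rewrite ?inE//.
    by have [] := (sVP v).1 vV.
  - by move=> v /sVP[].
  - move=> v Ov; apply: contraNeq => /(nearP _ _ PQ Ov)[y Qy vy].
    apply/sVP; split => //.
    apply: (@box_trans _ _ _ y _ (r + D) D); first lra.
      exact: (sFb _ QF _ Qy).
    exact: box_sym.
(* With margin [D], every region charging an inner center meets the box, and its unit ball lies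
   inside the box. *)
pose inner v := `[< box c (r - D) v >].
pose sI := [seq v <- sV | inner v]; pose sO := [seq v <- sV | ~~ inner v].
(* The whole star of an inner center lies in [sF], so this sum is its full score. *)
have innerS v : v \in sI -> \sum_(Q <- sF) sg Q v <= t.
  rewrite mem_filter => /andP[/asboolP cv /sVP[Ov _]].
  apply: le_trans (scoreP v Ov).
  pose s' := [seq Q <- sF | sg Q v != 0].
  rewrite (fsbigE s'); last 3 first.
  - by rewrite filter_uniq.
  - by move=> Q; rewrite /= mem_filter => /andP[? /sFP[]].
  - move=> Q [PQ sQ]; rewrite mem_filter sQ/=; apply: contraNeq => _; apply/sFP.
    split => //; have [y Qy vy] := nearP _ _ PQ Ov sQ; exists y; split => //.
    by apply: box_trans cv vy; lra.
  rewrite /s' big_filter_cond (bigID (fun Q => sg Q v != 0))/=.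
  rewrite [X in _ + X]big1 ?addr0; last by move=> Q /negPn/eqP.
  rewrite big_seq_cond [leRHS]big_seq_cond le_eqVlt; apply/orP; left; apply/eqP.
  apply: eq_bigl => Q; apply/andP/and3P => [[QF sQ]|[QF sQ _]]; split => //.
  by rewrite inE; split => //; have [] := (sFP Q).1 QF.
(* Part of the star may be missing here, and weights can be negative, so the score gives no control;
   the nonzero terms are counted instead. *)
have outerS v : v \in sO -> \sum_(Q <- sF) sg Q v <= N * W.
  rewrite mem_filter => /andP[_ /sVP[Ov _]].
  have [s' [s'N s'P]] := hitNP v.
  pose s1 := [seq Q <- sF | sg Q v != 0].
  have -> : \sum_(Q <- sF) sg Q v = \sum_(Q <- s1) sg Q v.
    rewrite /s1 big_filter (bigID (fun Q => sg Q v != 0))/=.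
    rewrite [X in _ + X]big1 ?addr0//.
    by move=> Q /negPn/eqP.
  apply: (@le_trans _ _ (W * (size s1)%:R)).
    apply: ler_sum_seq_const => Q; rewrite mem_filter => /andP[_ /sFP[PQ _]].
    exact: le_trans (ler_norm _) (bndP _ _ PQ Ov).
  rewrite mulrC ler_wpM2r// (le_trans _ s'N)// ler_nat uniq_leq_size ?filter_uniq//.
  move=> Q; rewrite mem_filter => /andP[sQ /sFP[PQ _]]; apply/s'P; split => //.
  by have [y Qy vy] := nearP _ _ PQ Ov sQ; exists y.
have usI : uniq sI by rewrite filter_uniq.
have usO : uniq sO by rewrite filter_uniq.
have sIO v : v \in sI -> Omega v by rewrite mem_filter => /andP[_ /sVP[]].
have sOO v : v \in sO -> Omega v by rewrite mem_filter => /andP[_ /sVP[]].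
have sVO v : v \in sV -> Omega v by move=> /sVP[].
have sizeV : (size sV)%:R = (size sI)%:R + (size sO)%:R :> R.
  by rewrite -natrD !size_filter count_predC.
have le_split : A * u - B * (2 * (r + D)) ^+ n <=
    t * (size sI)%:R + N * W * (size sO)%:R.
  apply: (le_trans total).
  rewrite (bigID inner)/=.
  rewrite -[X in X + _]big_filter.
  rewrite -[X in _ + X]big_filter.
  apply: lerD; first exact: ler_sum_seq_const innerS.
  exact: ler_sum_seq_const outerS.
have countI : kappa R n * (size sI)%:R <= u.
  apply: (packing_count n0 pO usI sIO bu) => v vI x vx; split.
    move: vI; rewrite mem_filter => /andP[/asboolP cv _].
    by apply: box_ball cv _ vx; lra.
  by apply/packed_regionP; exists v => //; exact: sIO.
have countV : u <= kappa R n * (size sV)%:R.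
  rewrite -(vol_balls n0 pO usV sVO); apply: le_vol; first by case: bu.
    exact: bounded_measurable_balls.
  move=> x [cx /packed_regionP[v Ov vx]]; apply/bigU_ballP; exists v => //.
  apply/sVP; split => //; apply: (box_trans _ cx (box_sym (ball_at_box vx))); lra.
(* Balls of outer centers avoid the box of half-side [r - 2 * D] and stay in that of half-side
   [r + 3 * D], because [1 <= D]. *)
have countO : kappa R n * (size sO)%:R <=
    (2 * (r + 3 * D)) ^+ n - (2 * (r - 2 * D)) ^+ n.
  have r2 : 0 <= r - 2 * D by lra.
  have r3 : 0 <= r + 3 * D by lra.
  rewrite lerBrDr -(vol_balls n0 pO usO sOO) -(vol_box c r2) -(vol_box c r3).
  have bO := bounded_measurable_balls sO.
  rewrite -vol_setU_null//; last 2 first.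
  - exact: bounded_measurable_box.
  - rewrite (_ : _ `&` _ = set0) ?vol0//.
    apply/seteqP; split => // x [/bigU_ballP[v + vx] cx].
    rewrite mem_filter => /andP[/asboolP + _]; apply.
    by apply: (box_trans _ cx (box_sym (ball_at_box vx))); lra.
  apply: le_vol; [|exact: bounded_measurable_box|].
    by case: (bounded_measurableU bO (bounded_measurable_box c (r - 2 * D))).
  move=> x [/bigU_ballP[v + vx]|cx i]; last by rewrite (le_trans (cx i))//; lra.
  rewrite mem_filter => /andP[_ /sVP[_ cv]].
  by apply: (box_trans _ cv (ball_at_box vx)); lra.
have NW : 0 <= N * W by rewrite mulr_ge0.
rewrite sizeV in countV.
(* The sign of [t] decides which count is used: the upper bound [countI] if [t] is nonnegative, the
   lower bound from [countV] if it is negative. *)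
have tI : t * (size sI)%:R <= t * u / kappa R n + `|t| * (size sO)%:R.
  have [t0|t0] := leP 0 t.
    rewrite (@le_trans _ _ (t * u / kappa R n))//; last first.
      by rewrite lerDl mulr_ge0.
    by rewrite -mulrA ler_wpM2l// ler_pdivlMr// mulrC.
  rewrite (ltr0_norm t0) mulNr -mulrA -mulrBr (ler_wnM2l (ltW t0))//.
  by rewrite lerBlDr ler_pdivrMr// mulrC.
have OX : (size sO)%:R <=
    ((2 * (r + 3 * D)) ^+ n - (2 * (r - 2 * D)) ^+ n) / kappa R n.
  by rewrite ler_pdivlMr// mulrC.
have := ler_wpM2l (addr_ge0 (normr_ge0 t) NW) OX.
rewrite [leRHS]mulrA mulrAC.
lra.
Qed.

End estimate.

(** * Limits over large cubes *)

Section large_cubes.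
Context (R : realType).

Lemma translate_cube_box n (T : R) (x : 'rV[R]_n) :
  translate (cube T) x = box (x + const_mx (T / 2)) (T / 2).
Proof.
apply/seteqP; split => [_ [y yT <-] i|y yb].
  by rewrite !mxE; have := yT i => /andP[]; rewrite ler_norml; lra.
exists (y - x); last by rewrite subrK.
by move=> i; have := yb i; rewrite !mxE ler_norml; lra.
Qed.

Lemma subset_box n (c : 'rV[R]_n) r s : r <= s -> box c r `<=` box c s.
Proof. by move=> rs x xr i; exact: le_trans (xr i) rs. Qed.

Lemma le_density n (Omega Omega' S : set 'rV[R]_n) : (0 < n)%N ->
  sphere_packing Omega -> sphere_packing Omega' -> bounded_measurable S ->
  Omega `<=` Omega' -> density Omega S <= density Omega' S.
Proof.
move=> n0 pO pO' bS OO'; rewrite ler_wpM2r ?invr_ge0 ?vol_ge0//; apply: le_vol.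
- by case: (measurable_packed n0 pO bS).
- exact: measurable_packed.
- move=> x [Sx [v Ov [b b1 vb]]]; split => //.
  by exists v; [exact: OO'|exists b].
Qed.

(** Divided by [T ^+ n], the left side is a polynomial in [1 / T] with value [B] at 0, and
    continuity at 0 concludes. The shifts are the margins of the box estimate with [T = 2 * r]. *)
Lemma expansion_limit (B E D e : R) n : 0 < e -> exists M : R, forall T : R, M < T ->
  [/\ 0 < T, 4 * D <= T &
   B * (T + 2 * D) ^+ n + E * ((T + 6 * D) ^+ n - (T - 4 * D) ^+ n)
     <= (B + e) * T ^+ n].
Proof.
move=> e0.
pose p : {poly R} := B%:P * (1 + (2 * D)%:P * 'X) ^+ n
  + E%:P * ((1 + (6 * D)%:P * 'X) ^+ n - (1 - (4 * D)%:P * 'X) ^+ n).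
have pE x : p.[x] = B * (1 + 2 * D * x) ^+ n
    + E * ((1 + 6 * D * x) ^+ n - (1 - 4 * D * x) ^+ n) by rewrite /p !hornerE.
have p0 : p.[0] = B by rewrite pE !mulr0 subr0 addr0 !expr1n subrr mulr0 addr0 mulr1.
have pe : p.[0] < B + e by rewrite p0 ltrDl.
have /cvgr_lt/(_ _ pe)/nbhs_ballP[d /= d0 dP] := @continuous_horner R p 0.
exists (Num.max (4 * D) d^-1) => T; rewrite gt_max => /andP[DT dT].
have T0 : 0 < T by apply: lt_trans dT; rewrite invr_gt0.
split=> //; first exact: ltW.
have Tn : T != 0 by rewrite gt_eqF.
have : p.[T^-1] < B + e.
  apply: (dP T^-1); rewrite /ball/= sub0r normrN gtr0_norm ?invr_gt0//.
  by rewrite -[ltRHS]invrK ltf_pV2// posrE invr_gt0.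
have scale a : (1 + a * T^-1) ^+ n * T ^+ n = (T + a) ^+ n.
  by rewrite -exprMn mulrDl mul1r divfK.
rewrite pE => /ltW h; have Tn0 : 0 <= T ^+ n by rewrite exprn_ge0 // ltW.
rewrite (le_trans _ (ler_wpM2r Tn0 h))// -(scale (2 * D)) -(scale (6 * D)).
rewrite -[T - _]/(T + - (4 * D)) -scale mulNr le_eqVlt.
by apply/orP; left; apply/eqP; ring.
Qed.

Lemma limf_esup_pinfty_le (f : R -> \bar R) (M : R) (l : \bar R) :
  (forall T, M < T -> (f T <= l)%E) -> (limf_esup f (pinfty_nbhs R) <= l)%E.
Proof.
move=> fl; rewrite limf_esupE.
apply: (@le_trans _ _ (ereal_sup (f @` [set T | M < T]))).
  apply: ereal_inf_lbound; exists [set T | M < T] => //.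
  by exists M; split => //; exact: num_real.
by apply: ge_ereal_sup => _ [T MT <-]; exact: fl.
Qed.

End large_cubes.

(** * Passage to the packing density *)

Section conclusion.
Context (R : realType).

(** The value -oo is excluded by exhibiting a score: the empty packing extends to a saturated one,
    which has a center. *)
Lemma theta_fin n (P : partition_rule R n) (sigma : weight_function R n) (a : R) :
  (theta P sigma < a%:E)%E -> exists t, theta P sigma = t%:E.
Proof.
have [X sX _] : exists2 X : set 'rV[R]_n, saturated X & set0 `<=` X.
  by apply: saturation => ? ? [].
have [v Xv] := saturated_nonempty sX.
have : ((score P sigma X v)%:E <= theta P sigma)%E.
  apply: (@le_trans _ _ (ereal_sup [set (score P sigma X v)%:E | v in X])).
    by apply: ereal_sup_ubound; exists v.
  by apply: ereal_sup_ubound; exists X.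
by case: (theta P sigma) => // t _ _; exists t.
Qed.

Lemma score_le_theta n (P : partition_rule R n) (sigma : weight_function R n)
    t Omega v :
  theta P sigma = t%:E -> saturated Omega -> Omega v -> score P sigma Omega v <= t.
Proof.
move=> tE sO Ov; rewrite -lee_fin -tE.
apply: (@le_trans _ _ (ereal_sup [set (score P sigma Omega v)%:E | v in Omega])).
  by apply: ereal_sup_ubound; exists v.
by apply: ereal_sup_ubound; exists Omega.
Qed.

(** The threshold [M] is chosen before the packing and the cube, so the bound survives the supremum
    over positions. *)
Lemma saturated_density_bound n (P : partition_rule R n)
    (sigma : weight_function R n) (A B t e : R) : (0 < n)%N ->
  admissible_partition P -> admissible_weight P sigma A B ->
  theta P sigma = t%:E -> t < kappa R n * A -> 0 < e ->
  exists M : R, forall (Omega : set 'rV[R]_n) T x, saturated Omega -> M < T ->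
    density Omega (translate (cube T) x) <=
    kappa R n * B / (kappa R n * A - t) + e.
Proof.
move=> n0 [partP [Cp [Cp0 [diamP _ hitP]]] _] [[A0 B0 [W Wb]] [avgP wlP _]] tE tA e0.
have [Dw nearP] := weight_near wlP.
have k0 := kappa_gt0 R n.
pose D := `|Cp| + `|Dw| + 1.
have D1 : 1 <= D by rewrite /D; have := normr_ge0 Cp; have := normr_ge0 Dw; lra.
have CpD : Cp <= D by rewrite /D; have := ler_norm Cp; have := normr_ge0 Dw; lra.
have DwD : Dw <= D by rewrite /D; have := normr_ge0 Cp; have := ler_norm Dw; lra.
have [N hitN] := finite_hits hitP D.
have gap : 0 < kappa R n * A - t by rewrite subr_gt0.
(* Scaled so that the final division by [A - t / kappa R n] turns it into [e]. *)
pose e' := e * (kappa R n * A - t) / kappa R n.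
have e'0 : 0 < e' by rewrite divr_gt0// mulr_gt0.
pose E := (`|t| + `|N| * `|W|) / kappa R n.
have [M MP] := @expansion_limit R B E D e' n e'0.
exists M => Omega T x sO MT; have [T0 DT bound] := MP T MT.
have [regP covP disjP] := partP Omega sO; have [pO _] := sO.
have r0 : 0 <= T / 2 by rewrite divr_ge0// ltW.
have Tn : 0 < T ^+ n by rewrite exprn_gt0.
rewrite translate_cube_box; set c := x + _.
have volT : vol (box c (T / 2)) = T ^+ n by rewrite vol_box// mulrC divfK.
rewrite /density volT ler_pdivrMr//.
have := @box_density_bound R n Omega (P Omega) (sigma Omega) A B D `|N| `|W| t n0 pO
  (ltW A0) (ltW B0) D1 (normr_ge0 N) (normr_ge0 W).
move=> /(_ _ covP disjP _ _ _ _ _ _ _ c (T / 2)).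
have twice a : 2 * (T / 2 + a) = T + 2 * a by rewrite mulrDr mulrC divfK.
set u := vol _.
have -> : 2 * (T / 2 + D) = T + 2 * D by rewrite twice.
have -> : 2 * (T / 2 + 3 * D) = T + 6 * D by rewrite twice; ring.
have -> : 2 * (T / 2 - 2 * D) = T - 4 * D by rewrite twice; ring.
move=> est.
have {est} : A * u <= B * (T + 2 * D) ^+ n + t * u / kappa R n +
    E * ((T + 6 * D) ^+ n - (T - 4 * D) ^+ n).
  apply: est.
  - by move=> Q /regP[].
  - move=> Q y PQ Qy; apply: subset_trans (diameter_box (diamP _ _ sO PQ) Qy) _.
    exact: subset_box.
  - move=> Q v PQ Ov s0; have [y Qy vy] := nearP _ _ _ sO PQ Ov s0.
    by exists y => //; exact: subset_box vy.
  - move=> c' r; have [N' /(_ Omega c' sO)[s [us _ sP]]] := finite_hits hitP r.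
    by exists s.
  - move=> c'; have [s [_ sN sP]] := hitN Omega c' sO.
    by exists s; split => //; exact: le_trans sN (ler_norm N).
  - move=> Q v PQ Ov; apply: le_trans (ltW (Wb _ _ _ sO PQ Ov)) (ler_norm W).
  - by move=> Q PQ; exact: avgP.
  - by move=> v Ov; exact: score_le_theta.
  - by rewrite ler_pdivlMr//; lra.
move=> est.
have key : (A - t / kappa R n) * u <= (B + e') * T ^+ n.
  by rewrite mulrBl mulrAC; lra.
have gapE : A - t / kappa R n = (kappa R n * A - t) / kappa R n.
  by rewrite mulrBl mulrAC divff ?mul1r// gt_eqF.
have gap' : 0 < A - t / kappa R n by rewrite gapE divr_gt0.
move: key; rewrite mulrC -ler_pdivlMr// => /le_trans; apply.
rewrite le_eqVlt; apply/orP; left; apply/eqP.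
rewrite gapE /e'; field.
by rewrite !gt_eqF.
Qed.

End conclusion.

Theorem theorem2p1 (R : realType) (n : nat) (P : partition_rule R n)
    (sigma : weight_function R n) (A B : R) :
  (1 <= n)%N ->
  admissible_partition P ->
  admissible_weight P sigma A B ->
  (theta P sigma < (kappa R n * A)%R%:E)%E ->
  (packing_density R n <=
     (kappa R n * B)%R%:E / ((kappa R n * A)%R%:E - theta P sigma))%E.
Proof.
move=> n0 aP aW tA.
have [t tE] := theta_fin tA.
move: tA; rewrite tE lte_fin => tA.
have gap : 0 < kappa R n * A - t by rewrite subr_gt0.
(* The denominator is a nonzero real, so the extended inverse is the real one. *)
rewrite -EFinB inver gt_eqF// -EFinM.
apply: ge_ereal_sup => _ [X pX <-].
apply/lee_addgt0Pr => e e0; rewrite -EFinD.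
have [M MP] := saturated_density_bound n0 aP aW tE tA e0.
(* Adding centers can only raise the density in each cube, so the bound for [Y] applies to [X]. *)
have [Y sY XY] := saturation pX.
have [pY _] := sY.
apply: (@limf_esup_pinfty_le _ _ M) => T MT.
apply: ge_ereal_sup => _ [x _ <-]; rewrite lee_fin.
apply: le_trans (MP _ _ x sY MT).
apply: le_density => //.
rewrite translate_cube_box; exact: bounded_measurable_box.
Qed.
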